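(* For any fixed integers $q\ge 1$, $p\ge 0$ and $k\ge q+1$, we have $$\beta_{p,q}(n,k)=(\beta(q)+o(1))\binom{n-2q-p-1}{k-p-q-1}\quad\text{as } n\to\infty.$$
   Context: $[n]=\{1,\dots,n\}$ and $\binom{[n]}{k}$ is the family of all $k$-subsets of $[n]$. A family $\mathcal{F}$ is intersecting if $F\cap F'\neq\emptyset$ for all $F,F'\in\mathcal{F}$. For a family $\mathcal{F}$ and disjoint sets $A,B$, let $\mathcal{F}(A,\overline{B})=\{F\in\mathcal{F}: A\subseteq F,\ B\cap F=\emptyset\}$. For $\mathcal{F}\subseteq 2^{[n]}$, $\beta_{p,q}(\mathcal{F})=\min\{|\mathcal{F}(A,\overline{B})|: |A|=p,\ |B|=q,\ A\cap B=\emptyset,\ A,B\subseteq[n]\}$, and $\beta_{p,q}(n,k)=\max\{\beta_{p,q}(\mathcal{F}): \mathcal{F}\subseteq\binom{[n]}{k},\ \mathcal{F}\text{ intersecting}\}$. The quantity $\beta_{0,q}(n,q+1)$ is constant for all sufficiently large $n$; $\beta(q)$ denotes this constant value. *)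

(* Defs.v *)
From mathcomp Require Import all_boot all_order all_algebra.
From mathcomp Require Import all_classical all_reals all_analysis.

Set Implicit Arguments.
Unset Strict Implicit.
Unset Printing Implicit Defensive.

Import Order.TTheory GRing.Theory Num.Theory.

Local Open Scope nat_scope.

Definition k_uniform n (k : nat) (FF : {set {set 'I_n}}) : bool :=
  [forall F in FF, #|F| == k].

Definition intersecting n (FF : {set {set 'I_n}}) : bool :=
  [forall F in FF, forall G in FF, F :&: G != finset.set0].

Definition subfam n (FF : {set {set 'I_n}}) (A B : {set 'I_n}) :
  {set {set 'I_n}} := [set F in FF | (A \subset F) && [disjoint B & F]].

(* beta_{p,q}(F).  Every term is at most #|FF|, so the default value #|FF| of
   the iterated minimum only shows when there is no admissible pair (A, B),
   that is when n < p + q. *)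
Definition beta_fam n (p q : nat) (FF : {set {set 'I_n}}) : nat :=
  \big[minn/#|FF|]_(AB : {set 'I_n} * {set 'I_n} |
      [&& #|AB.1| == p, #|AB.2| == q & [disjoint AB.1 & AB.2]])
    #|subfam FF AB.1 AB.2|.

(* beta_{p,q}(n,k).  The empty family is always admissible. *)
Definition beta_max (p q n k : nat) : nat :=
  \max_(FF : {set {set 'I_n}} | k_uniform k FF && intersecting FF)
    beta_fam p q FF.

(* beta(q): the eventual value of the sequence n |-> beta_{0,q}(n,q+1)
   (0 would be returned if the sequence were not eventually constant). *)
Definition beta_const (q : nat) : nat :=
  xget 0 [set b : nat | \forall n \near \oo, beta_max 0 q n q.+1 = b]%classic.

(* Binomial coefficient with integer arguments, 0 as soon as one of them is
   negative; truncated subtraction on nat would instead give 'C(m, 0) = 1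
   for a negative lower index. *)
Definition binz (m j : int) : nat :=
  match m, j with
  | Posz m', Posz j' => 'C(m', j')
  | _, _ => 0
  end.

(* Main.v *)
(* Branching shows that a k-uniform family has a bounded number of hitting sets
   of size at most k below which every such hitting set lies.  If the family is
   a maximal intersecting one, these base sets meet pairwise.  A base set of
   size at most q can be put inside B, leaving no set at all; otherwise the base
   sets of size q+1 form an intersecting family, B is chosen optimally for it,
   and A is chosen away from the base, so the sets containing A and a base set
   of size q+1 give the main term and those containing A and a larger base set
   are negligible.  Conversely, if beta_{0,q}(n,q+1) is positive then an optimal
   (q+1)-uniform family has bounded size, and the family of all k-sets that
   contain one of its members attains the main term.  *)
Require Import Defs.
From mathcomp Require Import all_boot all_order all_algebra.
From mathcomp Require Import zify lra.
From mathcomp Require boolp.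

Set Implicit Arguments.
Unset Strict Implicit.
Unset Printing Implicit Defensive.

Local Open Scope nat_scope.

(** * Finite sets: interpolation and counting supersets *)

Lemma exists_set_between (T : finType) (X Y : {set T}) m :
  X \subset Y -> #|X| <= m -> m <= #|Y| ->
  exists Z : {set T}, [/\ X \subset Z, Z \subset Y & #|Z| = m].
Proof.
move=> sXY leXm lemY.
have dXY : #|Y :\: X| = #|Y| - #|X| by rewrite cardsD (setIidPr sXY).
have : 0 < #|[set Z : {set T} | (Z \subset Y :\: X) & #|Z| == m - #|X|]|.
  by rewrite cards_draws bin_gt0 dXY leq_sub2r.
case/card_gt0P => Z; rewrite inE subsetD => /andP[/andP[sZY dZX] /eqP cZ].
exists (X :|: Z); split; first exact: subsetUl.
  by rewrite subUset sXY.
by rewrite cardsU disjoint_setI0 1?disjoint_sym // cards0 cZ subn0 subnKC.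
Qed.

(** Fix an [s]-subset [Y] of [X]: [F :\: Y] determines [F] and has [k - s] elements. The factor
    [(s <= k)] is there because truncated subtraction would give the value 1 when no such [F]
    exists. *)
Lemma card_supersets (T : finType) k s (X : {set T}) : s <= #|X| ->
  #|[set F : {set T} | (#|F| == k) && (X \subset F)]|
    <= (s <= k) * 'C(#|T|, k - s).
Proof.
move=> lesX; have [||Y [_ sYX cY]] := exists_set_between (sub0set X) (m := s).
- by rewrite cards0.
- by [].
have [lesk | ltks] := leqP s k; last first.
  rewrite mul0n leqn0 cards_eq0 -subset0; apply/subsetP => F.
  rewrite !inE => /andP[/eqP cF sXF].
  have := subset_leq_card (subset_trans sYX sXF).
  by rewrite cY cF leqNgt ltks.
rewrite mul1n -card_draws -(card_in_imset (f := fun F : {set T} => F :\: Y)).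
  apply/subset_leq_card/subsetP => _ /imsetP[F + ->].
  rewrite !inE => /andP[/eqP cF sXF].
  by rewrite cardsD (setIidPr (subset_trans sYX sXF)) cF cY.
move=> F G; rewrite !inE => /andP[_ sF] /andP[_ sG] eqFG.
by rewrite -(setID F Y) -(setID G Y) eqFG !(setIidPr (subset_trans sYX _)).
Qed.

Lemma leq_card_cover_mul (T : finType) (FF : {set {set T}}) k :
  (forall F, F \in FF -> #|F| <= k) -> #|cover FF| <= #|FF| * k.
Proof.
move=> leFk; apply: leq_trans (leq_card_cover FF) _.
by rewrite -sum_nat_const; apply: leq_sum.
Qed.

(** * Hitting sets and bounded bases *)

Definition hitting (T : finType) (FF : {set {set T}}) (X : {set T}) :=
  [forall F in FF, X :&: F != set0].

Lemma hittingP (T : finType) (FF : {set {set T}}) (X : {set T}) :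
  reflect (forall F, F \in FF -> X :&: F != set0) (hitting FF X).
Proof. exact: forall_inP. Qed.

Lemma leq_card_bigcup (I T : finType) (P : pred I) (F : I -> {set T}) :
  #|\bigcup_(i | P i) F i| <= \sum_(i | P i) #|F i|.
Proof.
elim/big_rec2: _ => [|i n U _ leU]; first by rewrite cards0.
by apply: leq_trans (leq_card_setU _ _) _; rewrite leq_add2l.
Qed.

(* Branching: as long as S misses some F in FF, a hitting set containing S
   contains S together with one of the at most k elements of F. *)
Lemma hitting_base_above (T : finType) (FF : {set {set T}}) k m
    (S : {set T}) :
  0 < k -> (forall F, F \in FF -> #|F| <= k) ->
  exists BB : {set {set T}},
    [/\ #|BB| <= k ^ m,
        forall E, E \in BB -> hitting FF E /\ #|E| <= #|S| + m
      & forall X, hitting FF X -> S \subset X -> #|X| <= #|S| + m ->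
          exists2 E, E \in BB & E \subset X].
Proof.
move=> k_gt0 leFk; elim: m S => [|m IHm] S.
  have [hS | nhS] := boolP (hitting FF S).
    exists [set S]; split=> [|E /set1P->|X _ sSX _].
    - by rewrite cards1.
    - by rewrite leq_addr.
    - by exists S; rewrite ?set11.
  exists set0; split=> [|E|X hX sSX]; rewrite ?cards0 ?inE //.
  rewrite addn0 => leXS; have eSX : S = X by apply/eqP; rewrite eqEcard sSX.
  by rewrite eSX hX in nhS.
have [hS | nhS] := boolP (hitting FF S).
  exists [set S]; split=> [|E /set1P->|X _ sSX _].
  - by rewrite cards1 expn_gt0 k_gt0.
  - by rewrite leq_addr.
  - by exists S; rewrite ?set11.
have /forall_inPn[F FF_F] := nhS; rewrite negbK => /eqP SF0.
have [f fP] := fin_all_exists (fun x => IHm (x |: S)).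
(* [S] misses [F], so [x] is new and each branching spends exactly one unit of the size budget. *)
have cxS x : x \in F -> #|x |: S| = #|S|.+1.
  move=> Fx; rewrite cardsU1; case: (boolP (x \in S)) => // Sx.
  by have := in_set0 x; rewrite -SF0 inE Sx Fx.
exists (\bigcup_(x in F) f x); split.
- apply: leq_trans (leq_card_bigcup _ _) _.
  apply: (@leq_trans (\sum_(x in F) k ^ m)).
    by apply: leq_sum => x _; case: (fP x).
  by rewrite sum_nat_const expnS leq_mul2r leFk ?orbT.
- move=> E /bigcupP[x Fx fxE]; case: (fP x) => _ /(_ E fxE)[hE leE] _.
  by split=> //; rewrite -addSnnS -(cxS x Fx).
- move=> X hX sSX leX; have /set0Pn[x] := hittingP _ _ hX F FF_F.
  rewrite inE => /andP[Xx Fx]; case: (fP x) => _ _ /(_ X hX).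
  rewrite subUset sub1set Xx sSX cxS // addSnnS => /(_ isT leX)[E fxE sEX].
  by exists E => //; apply/bigcupP; exists x.
Qed.

Lemma hitting_base (T : finType) (FF : {set {set T}}) k :
  0 < k -> (forall F, F \in FF -> #|F| <= k) ->
  exists BB : {set {set T}},
    [/\ #|BB| <= k ^ k,
        forall E, E \in BB -> hitting FF E /\ #|E| <= k
      & forall X, hitting FF X -> #|X| <= k ->
          exists2 E, E \in BB & E \subset X].
Proof.
move=> k_gt0 leFk.
have [BB []] := hitting_base_above k set0 k_gt0 leFk.
rewrite cards0 add0n => cBB hBB BBX; exists BB; split=> // X hX.
exact/BBX/sub0set.
Qed.

(** * Working rules for [beta_fam] and [beta_max] *)

Lemma k_uniformP n k (FF : {set {set 'I_n}}) :
  reflect (forall F, F \in FF -> #|F| = k) (k_uniform k FF).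
Proof. by apply: (iffP forall_inP) => H F /H /eqP. Qed.

Lemma intersectingP n (FF : {set {set 'I_n}}) :
  reflect (forall F G, F \in FF -> G \in FF -> F :&: G != set0)
          (intersecting FF).
Proof.
apply: (iffP forall_inP) => [H F G /H /forall_inP|H F FF_F]; first by apply.
by apply/forall_inP => G; apply: H.
Qed.

Lemma intersecting_hitting n (FF : {set {set 'I_n}}) F :
  intersecting FF -> F \in FF -> hitting FF F.
Proof. by move=> /intersectingP iFF FF_F; apply/hittingP => G; apply: iFF. Qed.

Lemma beta_fam_le n p q (FF : {set {set 'I_n}}) (A B : {set 'I_n}) :
  #|A| = p -> #|B| = q -> [disjoint A & B] ->
  beta_fam p q FF <= #|subfam FF A B|.
Proof.
move=> cA cB dAB; rewrite /beta_fam -minEnat.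
apply: (Order.TotalTheory.bigmin_le_cond _ (j := (A, B))
  (fun AB : {set 'I_n} * {set 'I_n} => #|subfam FF AB.1 AB.2|)).
by rewrite /= cA cB !eqxx dAB.
Qed.

Lemma le_beta_fam n p q m (FF : {set {set 'I_n}}) : p + q <= n ->
  (forall A B : {set 'I_n}, #|A| = p -> #|B| = q -> [disjoint A & B] ->
     m <= #|subfam FF A B|) ->
  m <= beta_fam p q FF.
Proof.
move=> lepqn mFF; rewrite /beta_fam.
elim/big_rec: _ => [|[A B] x /and3P[/eqP cA /eqP cB dAB] lemx]; last first.
  by rewrite leq_min lemx mFF.
(* The default value [#|FF|] must be at least [m] too: it dominates the term of any admissible pair,
   and [p + q <= n] provides one. *)
have [| |A [_ _ cA]] := exists_set_between (sub0set [set: 'I_n]) (m := p).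
- by rewrite cards0.
- by rewrite cardsT card_ord (leq_trans (leq_addr q p)).
have [| |B [_ sB cB]] := exists_set_between (sub0set (~: A)) (m := q).
- by rewrite cards0.
- by rewrite cardsCs setCK card_ord cA; lia.
apply: leq_trans (mFF A B cA cB _) _.
  by rewrite disjoint_sym disjoints_subset.
by apply/subset_leq_card/subsetP => F; rewrite inE => /andP[].
Qed.

Lemma exists_beta_fam n p q (FF : {set {set 'I_n}}) : p + q <= n ->
  exists A B : {set 'I_n}, [/\ #|A| = p, #|B| = q, [disjoint A & B]
    & #|subfam FF A B| <= beta_fam p q FF].
Proof.
move=> lepqn.
have [/existsP[A /existsP[B /and4P[/eqP cA /eqP cB dAB leAB]]] |] := boolP
  [exists A : {set 'I_n}, exists B : {set 'I_n},
    [&& #|A| == p, #|B| == q, [disjoint A & B]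
      & #|subfam FF A B| <= beta_fam p q FF]]; first by exists A, B.
move=> /existsPn noAB.
suff : (beta_fam p q FF).+1 <= beta_fam p q FF by rewrite ltnn.
apply: le_beta_fam => // A B cA cB dAB.
have /existsPn/(_ B) := noAB A.
by rewrite cA cB !eqxx dAB /= -ltnNge.
Qed.

Lemma exists_beta_max n p q k : exists FF : {set {set 'I_n}},
  [/\ k_uniform k FF, intersecting FF & beta_fam p q FF = beta_max p q n k].
Proof.
rewrite /beta_max; have [|FF /andP[uFF iFF] ->] := eq_bigmax_cond
    (A := fun FF : {set {set 'I_n}} => k_uniform k FF && intersecting FF)
    (beta_fam p q).
  by apply/card_gt0P; exists set0; apply/andP; split;
     [apply/k_uniformP | apply/intersectingP] => F; rewrite inE.
by exists FF.
Qed.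

Lemma le_beta_max n p q k (FF : {set {set 'I_n}}) :
  k_uniform k FF -> intersecting FF -> beta_fam p q FF <= beta_max p q n k.
Proof.
move=> uFF iFF; have /bigmax_leqP := leqnn (beta_max p q n k).
by apply; rewrite uFF.
Qed.

Lemma beta_max_le n p q k m :
  (forall FF : {set {set 'I_n}}, k_uniform k FF -> intersecting FF ->
     beta_fam p q FF <= m) ->
  beta_max p q n k <= m.
Proof. by move=> H; apply/bigmax_leqP => FF /andP[]; apply: H. Qed.

Lemma subfamP n (FF : {set {set 'I_n}}) (A B F : {set 'I_n}) :
  reflect [/\ F \in FF, A \subset F & [disjoint B & F]] (F \in subfam FF A B).
Proof. by rewrite inE; apply: and3P. Qed.

Lemma exists_disjoint_set n m (B : {set 'I_n}) : m + #|B| <= n ->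
  exists2 A : {set 'I_n}, #|A| = m & [disjoint A & B].
Proof.
move=> lemBn; have [| |A [_ sAB cA]] :=
  exists_set_between (sub0set (~: B)) (m := m).
- by rewrite cards0.
- by rewrite cardsCs setCK card_ord; lia.
by exists A; rewrite // disjoints_subset.
Qed.

(** * Small hitting sets, and stabilization of [beta_max 0 q n q.+1] *)

(** Enlarge [E] to a [q]-set [B]: every member of [FF] meets [B], so nothing survives its
    exclusion. *)
Lemma beta_fam_hitting n p q (FF : {set {set 'I_n}}) (E : {set 'I_n}) :
  p + q <= n -> hitting FF E -> #|E| <= q -> beta_fam p q FF = 0.
Proof.
move=> lepqn hE leEq.
have [| |B [sEB _ cB]] := exists_set_between (subsetT E) (m := q) => //.
  by rewrite cardsT card_ord; lia.
have [|A cA dAB] := exists_disjoint_set (m := p) (B := B); first by rewrite cB.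
apply/eqP; rewrite -leqn0; apply: leq_trans (beta_fam_le FF cA cB dAB) _.
rewrite leqn0 cards_eq0 -subset0; apply/subsetP => F /subfamP[FF_F _ dBF].
have /eqP[] := hittingP _ _ hE F FF_F.
exact/disjoint_setI0/(disjointWl sEB).
Qed.

(** Each member of [FF] hits [FF], hence contains a base set. Positivity rules out base sets of size
    at most [q], so the member is itself a base set. The bound does not depend on [n]. *)
Lemma card_beta_fam_gt0 n p q (FF : {set {set 'I_n}}) : p + q <= n ->
  k_uniform q.+1 FF -> intersecting FF -> 0 < beta_fam p q FF ->
  #|FF| <= q.+1 ^ q.+1.
Proof.
move=> lepqn uFF iFF b_gt0.
have cFF F : F \in FF -> #|F| = q.+1 by move/(k_uniformP _ _ uFF).
have [|BB [cBB hBB BBX]] := hitting_base (FF := FF) (ltn0Sn q).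
  by move=> F /cFF->.
apply: leq_trans cBB; apply/subset_leq_card/subsetP => F FF_F.
have [||E BB_E sEF] := BBX F; first exact: intersecting_hitting FF_F.
  by rewrite cFF.
have [hE leE] := hBB E BB_E; suff -> : F = E by [].
apply/esym/eqP; rewrite eqEcard sEF cFF // ltnNge.
apply: contraL b_gt0 => leEq; by rewrite (beta_fam_hitting lepqn hE leEq).
Qed.

Lemma beta_max_le_const n q : q <= n -> beta_max 0 q n q.+1 <= q.+1 ^ q.+1.
Proof.
move=> leqn; apply: beta_max_le => FF uFF iFF.
have [-> //|b_gt0] := posnP (beta_fam 0 q FF).
apply: leq_trans (card_beta_fam_gt0 (p := 0) leqn uFF iFF b_gt0).
have [B cB dB] : exists2 B : {set 'I_n}, #|B| = q
    & [disjoint B & (set0 : {set 'I_n})].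
  by apply: exists_disjoint_set; rewrite cards0 addn0.
rewrite disjoint_sym in dB.
apply: leq_trans (beta_fam_le FF (cards0 _) cB dB) _.
by apply/subset_leq_card/subsetP => F /subfamP[].
Qed.

Lemma beta_max_leS n q k : q <= n -> beta_max 0 q n k <= beta_max 0 q n.+1 k.
Proof.
move=> leqn; have [FF [uFF iFF <-]] := exists_beta_max n 0 q k.
pose f := widen_ord (leqnSn n).
have f_inj : injective f by move=> i j /(congr1 val)/= /val_inj.
pose GG := [set f @: (F : {set 'I_n}) | F in FF].
have uGG : k_uniform k GG.
  apply/k_uniformP => _ /imsetP[F FF_F ->].
  by rewrite card_imset // (k_uniformP _ _ uFF).
have iGG : intersecting GG.
  apply/intersectingP => _ _ /imsetP[F FF_F ->] /imsetP[G FF_G ->].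
  have /set0Pn[x] := intersectingP _ iFF F G FF_F FF_G.
  rewrite inE => /andP[Fx Gx]; apply/set0Pn; exists (f x).
  by rewrite inE !imset_f.
apply: leq_trans (le_beta_max 0 q uGG iGG).
apply: le_beta_fam; first by rewrite add0n leqW.
(* The trace of [B] on the old points may have fewer than [q] elements, because of the new point; it
   is padded to a [q]-set [B']. *)
move=> A B cA cB dAB; have [| |B' [sB' _ cB']] :=
  exists_set_between (subsetT (f @^-1: B)) (m := q).
- rewrite -cB -(card_imset _ f_inj); apply/subset_leq_card/subsetP.
  by move=> _ /imsetP[x Bx ->]; rewrite inE in Bx.
- by rewrite cardsT card_ord.
have d0 : [disjoint (set0 : {set 'I_n}) & B'].
  by rewrite disjoints_subset sub0set.
apply: leq_trans (beta_fam_le FF (cards0 _) cB' d0) _.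
rewrite -(card_imset _ (imset_inj f_inj)); apply/subset_leq_card/subsetP.
move=> _ /imsetP[F /subfamP[FF_F _ dF] ->]; apply/subfamP; split.
- exact: imset_f.
- by rewrite (cards0_eq cA) sub0set.
- rewrite disjoint_sym disjoints_subset; apply/subsetP => _ /imsetP[x Fx ->].
  rewrite inE; apply: contraL dF => Bfx; apply/pred0Pn; exists x.
  by rewrite /= Fx (subsetP sB') // inE.
Qed.

(** Once the largest value taken beyond [N] is reached, monotonicity prevents leaving it. *)
Lemma nondecreasing_bounded_constant (f : nat -> nat) N M :
  (forall n, N <= n -> f n <= f n.+1) -> (forall n, N <= n -> f n <= M) ->
  exists b N', forall n, N' <= n -> f n = b.
Proof.
move=> ndf leM; pose P v := boolp.asbool (exists2 n, N <= n & f n = v).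
have exP : exists v, P v by exists (f N); apply/boolp.asboolP; exists N.
have leP v : P v -> v <= M by move=> /boolp.asboolP[n leNn <-]; apply: leM.
case: (ex_maxnP exP leP) => b /boolp.asboolP[N' leNN' <-] max_b.
exists (f N'), N' => n leN'n; apply/eqP; rewrite eqn_leq max_b /=; last first.
  by apply/boolp.asboolP; exists n => //; apply: leq_trans leN'n.
elim: n leN'n => [|n IHn]; first by rewrite leqn0 => /eqP->.
rewrite leq_eqVlt => /predU1P[-> //|leN'n].
by apply: leq_trans (IHn leN'n) (ndf _ (leq_trans leNN' leN'n)).
Qed.

Lemma beta_max_eventually_constant q :
  exists b N, forall n, N <= n -> beta_max 0 q n q.+1 = b.
Proof.
apply: (@nondecreasing_bounded_constant _ q (q.+1 ^ q.+1)) => n leqn.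
  exact: beta_max_leS.
exact: beta_max_le_const.
Qed.

(** * Upper bound through maximal intersecting families *)

(** In an inclusion-maximal family, a hitting [k]-set could be added without losing any property, so
    it is already present; [0 < k] makes it meet itself. *)
Lemma maximal_intersecting n k (FF : {set {set 'I_n}}) :
  0 < k -> k_uniform k FF -> intersecting FF ->
  exists FM : {set {set 'I_n}},
    [/\ FF \subset FM, k_uniform k FM, intersecting FM
      & forall X, hitting FM X -> #|X| = k -> X \in FM].
Proof.
move=> k_gt0 uFF iFF.
pose P (GG : {set {set 'I_n}}) := k_uniform k GG && intersecting GG.
have [|FM /maxsetP[/andP[uFM iFM] maxFM] sFF] := @maxset_exists _ P FF.
  by rewrite /P uFF.
exists FM; split=> // X hX cX; suff -> : FM = X |: FM by rewrite setU11.
apply/esym/maxFM; last exact: subsetUr.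
apply/andP; split.
  by apply/k_uniformP => F /setU1P[-> //|]; apply/k_uniformP.
apply/intersectingP => F G /setU1P[->|FM_F] /setU1P[->|FM_G].
- by rewrite setIid -card_gt0 cX.
- exact: (hittingP _ _ hX).
- by rewrite setIC; apply: (hittingP _ _ hX).
- exact: (intersectingP _ iFM).
Qed.

(** If [X] and [Y] were disjoint, [X] would extend to a [k]-set avoiding [Y]. That set still hits
    [FM], so it belongs to [FM], yet [Y] misses it. *)
Lemma maximal_hitting_meet n k (FM : {set {set 'I_n}}) (X Y : {set 'I_n}) :
  2 * k <= n -> (forall X, hitting FM X -> #|X| = k -> X \in FM) ->
  hitting FM X -> hitting FM Y -> #|X| <= k -> #|Y| <= k -> X :&: Y != set0.
Proof.
move=> le2kn maxFM hX hY leX leY; apply/negP => /eqP XY0.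
have [|||F [sXF sFY cF]] := @exists_set_between _ X (~: Y) k.
- by rewrite -disjoints_subset -setI_eq0 XY0.
- by [].
- by rewrite cardsCs setCK card_ord; lia.
have FM_F : F \in FM.
  apply: maxFM => //; apply/hittingP => G FM_G.
  apply: contraNneq (hittingP _ _ hX G FM_G) => FG0.
  by rewrite -subset0 -FG0 setSI.
have /eqP[] := hittingP _ _ hY F FM_F.
by apply: disjoint_setI0; rewrite disjoint_sym disjoints_subset.
Qed.

Lemma beta_max_upper n p q k b :
  0 < k -> 2 * k <= n -> p + q + k ^ k * k <= n ->
  beta_max 0 q n q.+1 <= b ->
  beta_max p q n k <= b * ((p + q.+1 <= k) * 'C(n, k - (p + q.+1)))
    + k ^ k * ((p + q.+2 <= k) * 'C(n, k - (p + q.+2))).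
Proof.
move=> k_gt0 le2kn len leb; apply: beta_max_le => FF uFF iFF.
have [FM [sFM uFM iFM maxFM]] := maximal_intersecting k_gt0 uFF iFF.
have cFM F : F \in FM -> #|F| = k by move/(k_uniformP _ _ uFM).
have [|BB [cBB hBB BBX]] := hitting_base (FF := FM) k_gt0.
  by move=> F /cFM->.
have [/existsP[E /andP[BB_E leE]] | noE] := boolP
  [exists E, (E \in BB) && (#|E| <= q)].
  have [hE _] := hBB E BB_E; rewrite (@beta_fam_hitting _ _ _ _ E) //.
    by apply: leq_trans len; rewrite leq_addr.
  by apply/hittingP => F FF_F; apply: (hittingP _ _ hE); apply: (subsetP sFM).
have gtE E : E \in BB -> q < #|E|.
  by move=> BB_E; have /existsPn/(_ E) := noE; rewrite BB_E /= ltnNge.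
pose GG := [set E in BB | #|E| == q.+1].
have uGG : k_uniform q.+1 GG.
  by apply/k_uniformP => E; rewrite inE => /andP[_ /eqP].
have iGG : intersecting GG.
  apply/intersectingP => E E'; rewrite !inE => /andP[/hBB[hE leE] _].
  move=> /andP[/hBB[hE' leE'] _].
  exact: maximal_hitting_meet le2kn maxFM hE hE' leE leE'.
(* [Z] is empty, as [p] is 0 here; [B] leaves at most [b] base sets of size [q.+1] untouched. *)
have [|Z [B [cZ cB _ leB]]] := @exists_beta_fam n 0 q GG.
  by apply: leq_trans len; rewrite add0n addnAC leq_addl.
have {}leB : #|subfam GG Z B| <= b.
  exact: leq_trans leB (leq_trans (le_beta_max _ _ uGG iGG) leb).
(* The base covers at most [k ^ k * k] points, so there is room for [A] outside them and outside
   [B]. Then [A :|: E] has the full size [p + #|E|] for every base set [E]. *)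
have [|A cA] := @exists_disjoint_set n p (B :|: cover BB).
  apply: leq_trans len; rewrite -addnA leq_add2l.
  apply: leq_trans (leq_card_setU _ _) _; rewrite cB leq_add2l.
  apply: leq_trans (leq_card_cover_mul _) (leq_mul cBB (leqnn k)).
  by move=> E /hBB[].
rewrite disjoint_sym disjoints_subset subUset -!disjoints_subset => /andP[dBA dcA].
have dEA E : E \in BB -> [disjoint E & A].
  by move=> BB_E; apply: disjointWl dcA; apply: bigcup_sup.
have cAE E : E \in BB -> #|A :|: E| = p + #|E|.
  move=> BB_E; rewrite cardsU disjoint_setI0 ?cards0 ?subn0 ?cA //.
  by rewrite disjoint_sym dEA.
rewrite disjoint_sym in dBA; apply: leq_trans (beta_fam_le FF cA cB dBA) _.
pose sup E := [set F : {set 'I_n} | (#|F| == k) && (A :|: E \subset F)].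
pose BB1 := [set E in BB | [disjoint B & E]].
(* Each surviving [F] contains [A] and a base set, which avoids [B] because [F] does. *)
apply: (@leq_trans #|\bigcup_(E in BB1) sup E|).
  apply/subset_leq_card/subsetP => F /subfamP[FF_F sAF dBF].
  have FM_F := subsetP sFM F FF_F.
  have [||E BB_E sEF] := BBX F; rewrite ?cFM ?(intersecting_hitting iFM) //.
  apply/bigcupP; exists E; first by rewrite inE BB_E (disjointWr sEF).
  by rewrite inE cFM // eqxx subUset sAF.
apply: leq_trans (leq_card_bigcup _ _) _.
(* Base sets of size [q.+1] avoiding [B] are at most [b] in number; the others have size at least
   [q.+2] and number at most [k ^ k]. *)
rewrite (bigID (fun E : {set 'I_n} => #|E| == q.+1)) /=; apply: leq_add.
  set u := _ * 'C(n, _); apply: (@leq_trans (\sum_(E in subfam GG Z B) u)).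
    rewrite [leqLHS](eq_bigl (fun E => E \in subfam GG Z B)) => [|E].
      apply: leq_sum => E /subfamP[]; rewrite inE => /andP[BB_E /eqP cE] _ _.
      have := @card_supersets _ k (p + q.+1) (A :|: E).
      by rewrite card_ord cAE // cE leqnn => /(_ isT).
    by rewrite !inE (cards0_eq cZ) sub0set /= andbAC.
  by rewrite sum_nat_const leq_mul2r leB orbT.
set u := _ * 'C(n, _); apply: (@leq_trans (\sum_(E in BB) u)); last first.
  by rewrite sum_nat_const leq_mul2r cBB orbT.
rewrite [leqRHS](big_setID BB1) /= (setIidPr _); last first.
  by apply/subsetP => E; rewrite inE => /andP[].
apply: leq_trans (leq_addr _ _).
rewrite [leqRHS](bigID (fun E : {set 'I_n} => #|E| == q.+1)) /=.
apply: leq_trans (leq_addl _ _); apply: leq_sum => E /andP[].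
rewrite inE => /andP[BB_E _] neE.
have := @card_supersets _ k (p + q.+2) (A :|: E).
by rewrite card_ord cAE // leq_add2l ltn_neqAle eq_sym neE gtE // => /(_ isT).
Qed.

(** * Lower bound by supersets of an optimal [q.+1]-uniform family *)

Lemma card_draws_imset (T : finType) (FF : {set {set T}}) (W X : {set T}) r :
  [disjoint X & W] ->
  (forall R : {set T}, R \subset W -> #|R| = r -> X :|: R \in FF) ->
  'C(#|W|, r) <= #|FF|.
Proof.
move=> dXW FFR; rewrite -cards_draws.
rewrite -(card_in_imset (f := fun R : {set T} => X :|: R)).
  apply/subset_leq_card/subsetP => _ /imsetP[R + ->].
  by rewrite inE => /andP[sRW /eqP cR]; apply: FFR.
move=> R S; rewrite !inE => /andP[/setIidPl sRW _] /andP[/setIidPl sSW _].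
move=> /(congr1 (fun F => F :&: W)).
by rewrite !setIUl disjoint_setI0 // !set0U sRW sSW.
Qed.

(** The pair [(E, R)] is recovered from [A :|: E :|: R] as its traces on [V :\: A] and on [W]. *)
Lemma card_draws_imset2 (T : finType) (FF HH : {set {set T}})
    (V W A : {set T}) r :
  (forall E, E \in HH -> E \subset V :\: A) -> [disjoint V :|: A & W] ->
  (forall E R : {set T}, E \in HH -> R \subset W -> #|R| = r ->
     A :|: E :|: R \in FF) ->
  #|HH| * 'C(#|W|, r) <= #|FF|.
Proof.
move=> sHV dW FFR; rewrite -cards_draws -cardsX.
rewrite -(card_in_imset
  (f := fun ER : {set T} * {set T} => A :|: ER.1 :|: ER.2)).
  apply/subset_leq_card/subsetP => _ /imsetP[[E R] + ->].
  by rewrite !inE /= => /and3P[HE sRW /eqP cR]; apply: FFR.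
have VA (E R : {set T}) : E \in HH -> R \subset W ->
    (A :|: E :|: R) :&: (V :\: A) = E.
  move=> /sHV sE sRW; apply/setP => x; rewrite !inE.
  have [Ex | nEx] := boolP (x \in E).
    by have := subsetP sE x Ex; rewrite inE orbT.
  rewrite orbF; have [Ax | nAx] //= := boolP (x \in A).
  apply/negP => /andP[Rx Vx]; have := disjointFr dW (x := x).
  by rewrite inE Vx (subsetP sRW) // => /(_ isT).
have WE (E R : {set T}) : E \in HH -> R \subset W -> (A :|: E :|: R) :&: W = R.
  move=> /sHV sE sRW; rewrite setIUl (setIidPl sRW) disjoint_setI0 ?set0U //.
  apply: disjointWl dW; rewrite subUset subsetUr /=.
  by apply: subset_trans sE _; rewrite (subset_trans (subsetDl _ _)) ?subsetUl.
move=> [E R] [E' R']; rewrite !inE /= => /and3P[HE sR _] /and3P[HE' sR' _] eqER.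
by congr (_, _); [rewrite -(VA E R) // eqER VA | rewrite -(WE E R) // eqER WE].
Qed.

(** If [A] misses all members [E] of the optimal family that avoid [B], the sets made of [A], some
    [E] and [r] points away from the family's cover suffice. If [A] meets some [E], that [E] alone
    suffices, since overlap leaves at least [r.+1] free points. *)
Lemma beta_max_lower n p q r b :
  q.+1 ^ q.+1 * q.+1 + p + q <= n -> b * r.+1 + r + p + 2 * q <= n ->
  b <= beta_max 0 q n q.+1 ->
  b * 'C(n - (q.+1 ^ q.+1 * q.+1 + p + q), r)
    <= beta_max p q n (p + q.+1 + r).
Proof.
set c := _ * q.+1 => lecn lebn leb; have [->|b_gt0] := posnP b => //.
have [GG [uGG iGG eGG]] := exists_beta_max n 0 q q.+1.
have cGG E : E \in GG -> #|E| = q.+1 by move/(k_uniformP _ _ uGG).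
have cV : #|cover GG| <= c.
  apply: leq_trans (leq_card_cover_mul (k := q.+1) _) _.
    by move=> E /cGG->.
  rewrite leq_mul2r (card_beta_fam_gt0 (p := 0) (n := n)) ?orbT //.
    by apply: leq_trans lecn; rewrite leq_addl.
  by rewrite eGG; apply: leq_trans leb.
set k := p + q.+1 + r.
pose FF := [set F : {set 'I_n} | (#|F| == k) && [exists E in GG, E \subset F]].
have uFF : k_uniform k FF by apply/k_uniformP => F; rewrite inE => /andP[/eqP].
have iFF : intersecting FF.
  apply/intersectingP => F F'; rewrite !inE => /andP[_ /exists_inP[E GE sEF]].
  move=> /andP[_ /exists_inP[E' GE' sEF']].
  apply: contraNneq (intersectingP _ iGG E E' GE GE') => FF0.
  by rewrite -subset0 -FF0 setISS.
apply: leq_trans (le_beta_max _ _ uFF iFF).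
apply: le_beta_fam => [|A B cA cB dAB].
  by apply: leq_trans lecn; rewrite -addnA leq_addl.
pose HH := subfam GG set0 B.
have lebH : b <= #|HH|.
  apply: leq_trans leb _; rewrite -eGG; apply: beta_fam_le => //.
    by rewrite cards0.
  by rewrite disjoints_subset sub0set.
have inFF (E F : {set 'I_n}) : E \in HH -> A :|: E \subset F ->
    [disjoint B & F] -> #|F| = k -> F \in subfam FF A B.
  move=> /subfamP[GE _ _]; rewrite subUset => /andP[sAF sEF] dBF cF.
  by apply/subfamP; split=> //; rewrite inE cF eqxx; apply/exists_inP; exists E.
have [/exists_inP[E HE meetAE] | noE] := boolP
  [exists E in HH, ~~ [disjoint E & A]].
  have /subfamP[GE _ dBE] := HE.
  (* A common point of [A] and [E] brings their union down to at most [p + q] elements. *)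
  have [|||X [sX sXB cX]] := @exists_set_between _ (A :|: E) (~: B) (p + q).
  - by rewrite subUset -!disjoints_subset dAB disjoint_sym.
  - have : 0 < #|A :&: E| <= #|A|.
      by rewrite subset_leq_card ?subsetIl // andbT card_gt0 setIC setI_eq0.
    by rewrite cardsU cA (cGG E GE); move: #|A :&: E|; clear; lia.
  - by rewrite cardsCs setCK card_ord cB; clear -lebn; lia.
  have cW : #|~: (X :|: B)| = n - (p + q + q).
    rewrite cardsCs setCK card_ord cardsU cX cB disjoint_setI0 ?cards0 ?subn0 //.
    by rewrite disjoints_subset.
  apply: (@leq_trans 'C(#|~: (X :|: B)|, r.+1)).
    apply: (@leq_trans (b * 'C(n - (p + q + q), r))).
      rewrite leq_mul2l leq_bin2l ?orbT //.
      have leqc : q <= c by rewrite ltnW // leq_pmull ?expn_gt0.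
      by move: (c) leqc; clear; lia.
    (* With [m = n - (p + q + q)], [r.+1 * 'C(m, r.+1) = (m - r) * 'C(m, r)], and [lebn] gives
       [b * r.+1 <= m - r]. *)
    rewrite cW -(leq_pmul2l (ltn0Sn r)) mul_bin_left mulnA leq_mul2r.
    by apply/orP; right; clear -lebn; lia.
  apply: (card_draws_imset (X := X)).
    by rewrite disjoints_subset setCK subsetUl.
  move=> R; rewrite setCU subsetI => /andP[sRX sRB] cR; apply: (inFF E) => //.
  - exact: subset_trans sX (subsetUl _ _).
  - by rewrite disjoint_sym disjoints_subset subUset sXB.
  - rewrite cardsU disjoint_setI0 ?cards0 ?subn0 ?cX ?cR.
      by rewrite /k; clear; lia.
    by rewrite disjoint_sym disjoints_subset.
have dEA (E : {set 'I_n}) : E \in HH -> [disjoint E & A].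
  by move=> HE; have /exists_inPn/(_ E HE) := noE; rewrite negbK.
pose W := ~: (cover GG :|: A :|: B).
have cW : n - (c + p + q) <= #|W|.
  rewrite cardsCs setCK card_ord leq_sub2l //.
  apply: leq_trans (leq_card_setU _ _) _; rewrite cB leq_add2r.
  by apply: leq_trans (leq_card_setU _ _) _; rewrite cA leq_add2r.
apply: leq_trans (leq_mul lebH (leq_bin2l r cW)) _.
apply: (@card_draws_imset2 _ _ _ (cover GG) _ A).
- move=> E HE; have /subfamP[GE _ _] := HE.
  by rewrite subsetD dEA // andbT; exact: (bigcup_sup E).
- by rewrite disjoints_subset setCK subsetUl.
move=> E R HE; rewrite /W !setCU !subsetI => /andP[/andP[sRV sRA] sRB] cR.
have /subfamP[GE _ dBE] := HE.
apply: (inFF E) => //; first exact: subsetUl.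
  rewrite disjoint_sym disjoints_subset !subUset -!disjoints_subset dAB.
  by rewrite disjoint_sym dBE disjoints_subset.
rewrite cardsU disjoint_setI0 ?cards0 ?subn0; last first.
  rewrite disjoint_sym disjoints_subset setCU subsetI sRA /=.
  by apply: subset_trans sRV _; rewrite setCS; exact: (bigcup_sup E).
rewrite cardsU disjoint_setI0 ?cards0 ?subn0 ?cA ?(cGG E) ?cR //.
by rewrite disjoint_sym dEA.
Qed.

(** * Binomial estimates and the approximation over the naturals *)

(** By Pascal's rule, deleting one point costs at most ['C(n, r.-1)], and nothing when [r = 0]. *)
Lemma bin_le_sub n d r : d <= n ->
  'C(n, r) <= 'C(n - d, r) + d * ((0 < r) * 'C(n, r.-1)).
Proof.
case: r => [|r] ledn; first by rewrite !bin0 leq_addr.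
rewrite mul1n /=; elim: d ledn => [|d IHd] ltdn; first by rewrite subn0 leq_addr.
apply: leq_trans (IHd (ltnW ltdn)) _.
have -> : n - d = (n - d.+1).+1 by lia.
rewrite binS mulSn -!addnA leq_add2l leq_add2r.
by apply: leq_bin2l; rewrite leq_subr.
Qed.

(** For positive [r], start from [r * 'C(n, r) = (n - r.-1) * 'C(n, r.-1)], replace ['C(n, r)] using
    [bin_le_sub], and move the error left. One unit of the shift [r + r * d] is slack. *)
Lemma bin_pred_le n d r : d <= n ->
  (n - (r + r * d)) * ((0 < r) * 'C(n, r.-1)) <= r * 'C(n - d, r).
Proof.
move=> ledn; have := bin_le_sub r ledn.
case: r => [|r] /=; rewrite ?mul0n ?muln0 ?mul1n // => leC.
have eqC := mul_bin_left n r.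
have -> : n - (r.+1 + r.+1 * d) = n - r - (1 + r.+1 * d) by lia.
rewrite mulnBl -eqC leq_subLR.
apply: leq_trans (leq_mul (leqnn r.+1) leC) _.
by rewrite mulnDr addnC mulnDl mul1n !mulnA leq_add2r leq_addl.
Qed.

(** The boolean factor carries the zero convention for a negative lower index over to [nat]. *)
Lemma binz_sub n p q k : 2 * q + p + 1 <= n ->
  binz (n%:Z - 2 * q%:Z - p%:Z - 1)%R (k%:Z - p%:Z - q%:Z - 1)%R =
  (p + q.+1 <= k) * 'C(n - (2 * q + p + 1), k - (p + q.+1)).
Proof.
move=> len; have -> : (n%:Z - 2 * q%:Z - p%:Z - 1 = Posz (n - (2 * q + p + 1)))%R.
  by lia.
have [lek|ltk] := leqP (p + q.+1) k.
  have -> : (k%:Z - p%:Z - q%:Z - 1 = Posz (k - (p + q.+1)))%R by lia.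
  by rewrite mul1n.
by have -> : (k%:Z - p%:Z - q%:Z - 1 = Negz (p + q - k))%R by lia.
Qed.

(* The errors are all bounded by a multiple of 'C(n, r.-1), which is smaller
   than the main term by a factor linear in n. *)
Lemma beta_max_approx p q k b N0 : 0 < k ->
  (forall n, N0 <= n -> beta_max 0 q n q.+1 = b) ->
  exists K L N, forall n, N <= n ->
    let D := binz (n%:Z - 2 * q%:Z - p%:Z - 1)%R (k%:Z - p%:Z - q%:Z - 1)%R in
    (n - L) * beta_max p q n k <= (n - L) * (b * D) + K * D /\
    (n - L) * (b * D) <= (n - L) * beta_max p q n k + K * D.
Proof.
move=> k_gt0 Hb; pose d := 2 * q + p + 1.
pose c := q.+1 ^ q.+1 * q.+1 + p + q.
pose r := k - (p + q.+1).
(* The error terms are [b * d] from replacing [n] by [n - d], [k ^ k] from the larger base sets, and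
   [b * c] from the points lost in the lower bound. The factor [r] and the shift come from
   [bin_pred_le]. *)
exists ((b * d + k ^ k + b * c) * r), (r + r * d).
exists (N0 + d + c + 2 * k + (p + q + k ^ k * k) + (b * r.+1 + r + p + 2 * q)).
move=> n leN; rewrite (binz_sub k (n := n)) -/d -/r; last by rewrite -/d; lia.
have eqb : beta_max 0 q n q.+1 = b by apply: Hb; lia.
have le_up : _ <= _ := beta_max_upper (n := n) (p := p) (q := q) k_gt0
  ltac:(lia) ltac:(lia) (eq_leq eqb).
rewrite -/r in le_up; have [lek|ltk] := leqP (p + q.+1) k; last first.
  (* For [k] this small the upper bound and the main term both vanish. *)
  have h1 : (p + q.+1 <= k) = false by rewrite leqNgt ltk.
  have h2 : (p + q.+2 <= k) = false by rewrite addnS ltnNge (ltnW ltk).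
  rewrite h1 h2 !mul0n !muln0 leqn0 in le_up *.
  by rewrite (eqP le_up) /= !muln0.
rewrite lek mul1n /= in le_up.
have le_low : _ <= _ := beta_max_lower (n := n) (p := p) (q := q)
  (r := r) (b := b)
  ltac:(lia) ltac:(lia) (eq_leq (esym eqb)).
rewrite -/c (subnKC lek) in le_low; rewrite mul1n.
set D := 'C(n - d, r); set beta := beta_max p q n k in le_up le_low *.
have ledn : d <= n by lia.
have lecn : c <= n by lia.
set S := (0 < r) * 'C(n, r.-1).
have {}le_up : beta <= b * 'C(n, r) + k ^ k * S.
  move: le_up; have -> : (p + q.+2 <= k) = (0 < r) by rewrite subn_gt0 addnS.
  by have -> : k - (p + q.+2) = r.-1 by rewrite /r; lia.
have leS : (n - (r + r * d)) * S <= r * D by apply: bin_pred_le.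
have leD : 'C(n, r) <= D + d * S by apply: bin_le_sub.
have leC : 'C(n, r) <= 'C(n - c, r) + c * S by apply: bin_le_sub.
have leDC : D <= 'C(n, r) by apply: leq_bin2l; rewrite leq_subr.
move: (n - (r + r * d)) leS => m leS.
have up : beta <= b * D + (b * d + k ^ k) * S.
  apply: leq_trans le_up _; rewrite mulnDl addnA leq_add2r -mulnA -mulnDr.
  by rewrite leq_mul2l leD orbT.
have low : b * D <= beta + b * c * S.
  apply: leq_trans (leq_mul (leqnn b) (leq_trans leDC leC)) _.
  by rewrite mulnDr -mulnA leq_add2r.
have mS x : m * (x * S) <= x * r * D by rewrite mulnCA -mulnA leq_mul2l leS orbT.
split.
  apply: leq_trans (leq_mul (leqnn m) up) _; rewrite mulnDr leq_add2l.
  by apply: leq_trans (mS _) _; rewrite !leq_mul2r leq_addr !orbT.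
apply: leq_trans (leq_mul (leqnn m) low) _; rewrite mulnDr leq_add2l.
by apply: leq_trans (mS _) _; rewrite !leq_mul2r leq_addl !orbT.
Qed.

(* Passage to the limit *)
From mathcomp Require Import all_classical all_reals all_analysis.

Import Order.TTheory GRing.Theory Num.Theory.
Import numFieldNormedType.Exports.

Local Open Scope classical_set_scope.
Local Open Scope ring_scope.

Lemma beta_constE q b N :
  (forall n, (N <= n)%N -> beta_max 0 q n q.+1 = b) -> beta_const q = b.
Proof.
move=> Hb; apply: xget_unique => [|b' [N' _ Hb']]; first by exists N.
by rewrite -(Hb (maxn N N')) ?leq_maxl // -(Hb' (maxn N N')) //= leq_maxr.
Qed.

Lemma cvg_inv_subn (R : realType) (K L : nat) :
  (K%:R / (n - L)%N%:R : R) @[n --> \oo] --> (0 : R).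
Proof.
have h : ((n - L)%N%:R^-1 : R) @[n --> \oo] --> (0 : R).
  rewrite -(cvg_shiftn L.+1) /=.
  under eq_fun do rewrite -addSnnS addnK.
  exact: cvg_harmonic.
have := cvgMl_tmp (a := K%:R) h; rewrite mulr0; exact.
Qed.

(** The hypotheses express [|u n - b * D n| <= K * D n / (n - L)] with denominators cleared.
    Dividing by [D n] bounds [eps n] by [K / (n - L)]. *)
Lemma cvg_of_natmul_approx (R : realType) (b K L N : nat) (u D : nat -> nat) :
  (forall n, (N <= n)%N ->
    ((n - L) * u n <= (n - L) * (b * D n) + K * D n)%N /\
    ((n - L) * (b * D n) <= (n - L) * u n + K * D n)%N) ->
  exists eps : nat -> R, (eps n @[n --> \oo] --> (0 : R)) /\
    \forall n \near \oo, (u n)%:R = (b%:R + eps n) * (D n)%:R.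
Proof.
move=> H; pose eps n : R := if D n == 0%N then 0 else (u n)%:R / (D n)%:R - b%:R.
have le_eps n : (N + L < n)%N -> `|eps n| <= K%:R / (n - L)%N%:R.
  move=> ltn; rewrite /eps; have [D0|D_neq0] := eqVneq (D n) 0%N.
    by rewrite normr0 divr_ge0.
  have D_gt0 : 0 < (D n)%:R :> R by rewrite ltr0n lt0n.
  have m_gt0 : 0 < (n - L)%N%:R :> R by rewrite ltr0n; lia.
  have [|up low] := H n; first by lia.
  rewrite -(ler_nat R) !(natrD, natrM) in up.
  rewrite -(ler_nat R) !(natrD, natrM) in low.
  have -> : (u n)%:R / (D n)%:R - b%:R = ((u n)%:R - b%:R * (D n)%:R) / (D n)%:R :> R.
    by rewrite mulrBl mulfK // gt_eqF.
  rewrite normrM normfV (gtr0_norm D_gt0) ler_pdivrMr // mulrAC ler_pdivlMr //.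
  rewrite -[X in _ * X](gtr0_norm m_gt0) -normrM ler_norml.
  by apply/andP; split; lra.
exists eps; split.
  apply/norm_cvg0P; apply: squeeze_cvgr (cvg_cst 0) (cvg_inv_subn K L).
  by exists (N + L).+1 => // n /= ltn; rewrite normr_ge0 le_eps.
exists (N + L).+1 => // n /= ltn; rewrite /eps.
have [D0|D_neq0] := eqVneq (D n) 0%N; last first.
  by rewrite addrC subrK divfK // pnatr_eq0.
(* Where [D n] is 0, the first inequality with [L < n] forces [u n = 0], so the default value of
   [eps] is harmless. *)
have [|+ _] := H n; first by lia.
rewrite D0 !muln0 leqn0 muln_eq0 subn_eq0 => /orP[|/eqP->]; first by lia.
by rewrite !mulr0.
Qed.

Theorem theorem1p4 (R : realType) (p q k : nat)
    (hq : (1 <= q)%N) (hk : (q.+1 <= k)%N) :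
  exists eps : nat -> R,
    (eps n @[n --> \oo] --> (0 : R)) /\
    \forall n \near \oo,
      (beta_max p q n k)%:R =
      ((beta_const q)%:R + eps n) *
        (binz (n%:Z - 2 * q%:Z - p%:Z - 1) (k%:Z - p%:Z - q%:Z - 1))%:R :> R.
Proof.
have [b [N0 Hb]] := beta_max_eventually_constant q.
have [K [L [N approx]]] := beta_max_approx p (leq_ltn_trans (leq0n q) hk) Hb.
rewrite (beta_constE Hb); exact: cvg_of_natmul_approx approx.
Qed.
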